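(* Suppose that $K$ is closed at infinity, and that the POP $\inf\{f(\mathbf{x}):\mathbf{x}\in K\}$ admits a correlative sparsity pattern $(\mathbf{x}(1),\dots,\mathbf{x}(p))$ satisfying the running intersection property. (1) If $f\ge0$ on $K$, then for any $\epsilon>0$ there exist $\sigma_\ell\in\mathrm{QM}[\{x_0\}\cup\{\tilde g_j\}_{j\in J_\ell},\tilde{\mathbf{x}}(\ell)\cup\{w_\ell\}]$ and $\tau_\ell\in\mathbb{R}[\tilde{\mathbf{x}}(\ell)\cup\{w_\ell\}]$, $\ell=1,\dots,p$, such that $$\tilde f+\epsilon\left(\sum_{i=0}^n x_i^{d_0}+\sum_{\ell=1}^p w_\ell^{d_0}\right)=\sum_{\ell=1}^p\left(\sigma_\ell+\tau_\ell\left(\|\tilde{\mathbf{x}}(\ell)\|^2+w_\ell^2-1\right)\right).$$ (2) If $f>0$ on $K$ and $f$ is positive at infinity on $K$, then for any $\epsilon>0$ there exist $\sigma_\ell\in\mathrm{QM}[\{x_0\}\cup\{\tilde g_j\}_{j\in J_\ell},\tilde{\mathbf{x}}(\ell)\cup\{w_\ell\}]$ and $\tau_\ell\in\mathbb{R}[\tilde{\mathbf{x}}(\ell)\cup\{w_\ell\}]$, $\ell=1,\dots,p$, such that $$\tilde f+\epsilon\sum_{\ell=1}^p w_\ell^{d_0}=\sum_{\ell=1}^p\left(\sigma_\ell+\tau_\ell\left(\|\tilde{\mathbf{x}}(\ell)\|^2+w_\ell^2-1\right)\right).$$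
   Context: Let $\mathbf{x}=(x_1,\dots,x_n)$, $f,g_1,\dots,g_m\in\mathbb{R}[\mathbf{x}]$, $K=\{\mathbf{x}\in\mathbb{R}^n : g_j(\mathbf{x})\ge 0,\ j=1,\dots,m\}$, with $\inf_K f>-\infty$ assumed throughout. Put $d=\deg(f)$, $d_0=2\lceil d/2\rceil$. Let $\tilde{\mathbf{x}}=(x_0,x_1,\dots,x_n)$. For $q\in\mathbb{R}[\mathbf{x}]$, $\tilde q(\tilde{\mathbf{x}})=x_0^{\deg(q)}q(\mathbf{x}/x_0)$ is the homogenization and $q^{(\infty)}$ the homogeneous part of degree $\deg(q)$. Define $\widetilde K=\{\tilde{\mathbf{x}}\in\mathbb{R}^{n+1} : \tilde g_j(\tilde{\mathbf{x}})\ge 0\ (j=1,\dots,m),\ x_0\ge 0,\ \|\tilde{\mathbf{x}}\|^2=1\}$. $K$ is closed at infinity if $\widetilde K$ equals the closure of $\widetilde K\cap\{x_0>0\}$. Let $K^{(\infty)}=\{\mathbf{x}\in\mathbb{R}^n : g_j^{(\infty)}(\mathbf{x})\ge0\ (j=1,\dots,m),\ \|\mathbf{x}\|^2=1\}$; $f$ is positive (definite) at infinity on $K$ if $f^{(\infty)}>0$ on $K^{(\infty)}$. Variable sets $\mathbf{x}(1),\dots,\mathbf{x}(p)\subseteq\{x_1,\dots,x_n\}$ with union $\{x_1,\dots,x_n\}$ form a correlative sparsity pattern of the POP if $f=\sum_{\ell=1}^p f_\ell$ with $f_\ell\in\mathbb{R}[\mathbf{x}(\ell)]$, and there is a partition $\{J_1,\dots,J_p\}$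 of $\{1,\dots,m\}$ with $g_j\in\mathbb{R}[\mathbf{x}(\ell)]$ for all $j\in J_\ell$. It satisfies the running intersection property if for every $\ell\in\{1,\dots,p-1\}$ there is $s\in\{1,\dots,\ell\}$ with $\mathbf{x}(\ell+1)\cap\bigcup_{j=1}^{\ell}\mathbf{x}(j)\subseteq\mathbf{x}(s)$. The variables $w_1,\dots,w_p$ are auxiliary, $\tilde{\mathbf{x}}(\ell)=(x_0,\mathbf{x}(\ell))$. For a set of variables $V$ and finite $G\subset\mathbb{R}[V]$, $\Sigma[V]$ is the set of sums of squares in $\mathbb{R}[V]$, and $\mathrm{QM}[G,V]=\Sigma[V]+\sum_{g\in G}g\cdot\Sigma[V]$ is the quadratic module generated by $G$ in $\mathbb{R}[V]$. Identities are polynomial identities in $\mathbb{R}[x_0,\dots,x_n,w_1,\dots,w_p]$.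
   Formalization: The formal theorem additionally assumes that K is nonempty when f is constant; without this the claim fails, e.g. for f = −5 and g = −1 − x², where K is empty and the left side is negative at x̃ = 0, w = 1 for small ε. *)

(* Defs.v *)
From HB Require Import structures.
From mathcomp Require Import all_boot all_order all_algebra.
(* mpoly must be imported before the topology files: the other order makes
   their notations clash. *)
From mathcomp Require Import mpoly.
From mathcomp Require Import boolp classical_sets reals constructive_ereal.
From mathcomp Require Import ereal topology normedtype.

Set Implicit Arguments.
Unset Strict Implicit.
Unset Printing Implicit Defensive.

Import Order.TTheory GRing.Theory Num.Theory.
Import numFieldNormedType.Exports.

Local Open Scope classical_set_scope.
Local Open Scope ring_scope.

Section Homogenization.
Variables (R : realType) (n : nat).
Implicit Types q : {mpoly R[n]}.

(* Convention: the zero polynomial has degree 0. *)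
Definition tdeg q : nat := (msize q).-1.

(* x_0 is ord0 and x_i is the shifted index lift ord0 i. *)
Definition homogenize q : {mpoly R[n.+1]} :=
  \sum_(mo <- msupp q)
     q@_mo *: ('X_ord0 ^+ (tdeg q - mdeg mo)
               * \prod_(i < n) 'X_(lift ord0 i) ^+ mo i).

Definition top_form q : {mpoly R[n]} := pihomog (@mdeg n) (tdeg q) q.

End Homogenization.

Section Feasible.
Variables (R : realType) (n m : nat).
Implicit Types (f : {mpoly R[n]}) (g : 'I_m -> {mpoly R[n]}).

(* The norm of the library on 'rV is the max norm, so the Euclidean norm is
   written out. *)
Definition sqnorm k (x : 'rV[R]_k) : R := \sum_(i < k) x ord0 i ^+ 2.

Definition feasible g : set 'rV[R]_n :=
  [set x : 'rV[R]_n | forall j, 0 <= (g j).@[x ord0]].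

Definition feasible_hom g : set 'rV[R]_n.+1 :=
  [set y : 'rV[R]_n.+1 | [/\ forall j, 0 <= (homogenize (g j)).@[y ord0],
               0 <= y ord0 ord0 & sqnorm y = 1]].

Definition closed_at_infinity g : Prop :=
  feasible_hom g = closure (feasible_hom g `&` [set y : 'rV[R]_n.+1 | 0 < y ord0 ord0]).

Definition feasible_infty g : set 'rV[R]_n :=
  [set x : 'rV[R]_n | (forall j, 0 <= (top_form (g j)).@[x ord0]) /\ sqnorm x = 1].

Definition positive_at_infinity f g : Prop :=
  forall x, feasible_infty g x -> 0 < (top_form f).@[x ord0].

End Feasible.

Section Subrings.
Variables (R : realType) (N : nat).
Implicit Types (V : {set 'I_N}) (q : {mpoly R[N]}) (G : seq {mpoly R[N]}).

(* q lies in the subring R[V]. *)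
Definition poly_in V q : Prop :=
  forall mo, mo \in msupp q -> forall i, mo i != 0%N -> i \in V.

Definition sos V q : Prop :=
  exists s : seq {mpoly R[N]},
    (forall h, h \in s -> poly_in V h) /\ q = \sum_(h <- s) h ^+ 2.

Definition quadratic_module G V q : Prop :=
  exists (s0 : {mpoly R[N]}) (s : 'I_(size G) -> {mpoly R[N]}),
    [/\ sos V s0, forall i, sos V (s i)
      & q = s0 + \sum_(i < size G) G`_i * s i].

End Subrings.

Section Sparsity.
Variables (R : realType) (n m p : nat).
Implicit Types (f : {mpoly R[n]}) (g : 'I_m -> {mpoly R[n]}).
Implicit Types (X : 'I_p -> {set 'I_n}) (J : 'I_p -> {set 'I_m}).

(* The blocks J l of the partition of the constraints may be empty. *)
Definition correlative_sparsity f g X J : Prop :=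
  [/\ (\bigcup_(l < p) X l)%SET = [set: 'I_n]%SET,
      exists fl : 'I_p -> {mpoly R[n]},
        (forall l, poly_in (X l) (fl l)) /\ f = \sum_(l < p) fl l,
      (\bigcup_(l < p) J l)%SET = [set: 'I_m]%SET /\
        (forall l1 l2, l1 != l2 -> [disjoint J l1 & J l2]%B)
    & forall l j, j \in J l -> poly_in (X l) (g j)].

(* The 0-based index k stands for l + 1 in the usual 1-based formulation. *)
Definition running_intersection X : Prop :=
  forall k : 'I_p, (0 < k)%N ->
    exists2 s : 'I_p, (s < k)%N
      & X k :&: (\bigcup_(j < p | (j < k)%N) X j)%SET \subset X s.

(* The n.+1 + p variables are x_0, ..., x_n followed by w_1, ..., w_p. *)
Definition xvar (i : 'I_n.+1) : 'I_(n.+1 + p) := lshift p i.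
Definition wvar (l : 'I_p) : 'I_(n.+1 + p) := rshift n.+1 l.

Definition hom_ext (q : {mpoly R[n]}) : {mpoly R[n.+1 + p]} :=
  homogenize q \mPo [tuple 'X_(xvar i) | i < n.+1].

Definition xtilde X (l : 'I_p) : {set 'I_(n.+1 + p)} :=
  xvar ord0 |: [set xvar (lift ord0 i) | i in X l]%SET.

Definition block X (l : 'I_p) : {set 'I_(n.+1 + p)} := wvar l |: xtilde X l.

Definition block_sphere X (l : 'I_p) : {mpoly R[n.+1 + p]} :=
  \sum_(i in xtilde X l) 'X_i ^+ 2 + 'X_(wvar l) ^+ 2 - 1.

Definition block_gens g J (l : 'I_p) : seq {mpoly R[n.+1 + p]} :=
  'X_(xvar ord0) :: [seq hom_ext (g j) | j <- enum (J l)].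

Definition sparse_certificate g X J (h : {mpoly R[n.+1 + p]}) : Prop :=
  exists sigma tau : 'I_p -> {mpoly R[n.+1 + p]},
    [/\ forall l, quadratic_module (block_gens g J l) (block X l) (sigma l),
        forall l, poly_in (block X l) (tau l)
      & h = \sum_(l < p) (sigma l + tau l * block_sphere X l)].

End Sparsity.

(* Main.v *)
Require Import Defs.
From HB Require Import structures.
From mathcomp Require Import all_boot all_order all_algebra.
From mathcomp Require Import mpoly.
From mathcomp Require Import boolp classical_sets reals constructive_ereal.
From mathcomp Require Import ereal topology normedtype derive.
From mathcomp Require Import ring lra.

(** Homogenization turns the problem into one on a compact set.  Let [S] be the
    set of points [(x, w)] with [x] in R^(n+1), [x_0 >= 0], all homogenized
    constraints nonnegative at [x] and all block spheres satisfied.  The left-hand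
    side of either identity is positive on [S].  If [x = 0], every [w_l] is 1 or -1,
    the homogenized objective is nonnegative and the sum of the [w_l ^ d0] is
    positive.  If [x] is not 0, scaling puts it on the unit sphere, where the
    homogenized objective is nonnegative by closedness at infinity (part 1) or
    positive by positivity on [K] and at infinity (part 2).

    The left-hand side is also a sum of polynomials, one in each block of variables,
    and the blocks inherit the running intersection property.  So the theorem
    follows from a sparse Positivstellensatz ([sparse_putinar]) for blocks that
    come with a sphere equation, which rests on three facts.

    - Penalties.  All points of [S] lie in the box [-1, 1]^N.  Subtracting from the
      polynomial of each block the terms [lam (1 - u)^(2k) u] for its normalized
      constraints [u] and adding [lam t^2] for its sphere equation [t = 0] makes
      the sum positive on the whole box, for [lam] and [k] large
      ([compact_penalty], [weighted_penalty]).

    - Bernstein coefficients.  On the box, written as [0, 1]^N, the coefficients of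
      a polynomial in the Bernstein basis of degree [k] converge to its values
      on the grid of mesh [1/k] ([bernstein_coef_close]).  So for large [k] the
      coefficient functions of the blocks have a nonnegative sum on the grid.  Each
      depends on the coordinates of its block only, and the running intersection
      property lets one move parts of them between blocks, by minimizing over the
      fibres above the separators, until each is nonnegative ([redistribute]).
      As this happens on a finite grid, where any function is a coefficient
      function, nothing has to be approximated by polynomials.

    - Squares.  Each block is now a nonnegative combination of products of
      [(1 + x_i)/2] and [(1 - x_i)/2] with [x_i] in that block.  Modulo the sphere
      equation [1 - x_i^2] is a sum of squares of the other variables, so
      [1 + x_i = ((1 + x_i)^2 + (1 - x_i^2)) / 2] is a sum of squares, and
      so are all those products ([sos_mod_block_sphere]). *)

Set Implicit Arguments.
Unset Strict Implicit.
Unset Printing Implicit Defensive.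

Import Order.TTheory GRing.Theory Num.Theory.
Import numFieldNormedType.Exports.

Local Open Scope classical_set_scope.
Local Open Scope ring_scope.

(** * Polynomials in a block of variables *)

Section PolyIn.
Variables (R : realType) (N : nat).
Implicit Types (V W : {set 'I_N}) (q r : {mpoly R[N]}).

Lemma poly_in0 V : poly_in V (0 : {mpoly R[N]}).
Proof. by move=> mo; rewrite msupp0. Qed.

Lemma poly_in1 V : poly_in V (1 : {mpoly R[N]}).
Proof. by move=> mo; rewrite msupp1 inE => /eqP -> i; rewrite mnmE. Qed.

Lemma poly_inZ V (c : R) q : poly_in V q -> poly_in V (c *: q).
Proof. by move=> hq mo /msuppZ_le; exact: hq. Qed.

Lemma poly_inD V q r : poly_in V q -> poly_in V r -> poly_in V (q + r).
Proof.
by move=> hq hr mo /msuppD_le; rewrite mem_cat => /orP[/hq|/hr].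
Qed.

Lemma poly_inB V q r : poly_in V q -> poly_in V r -> poly_in V (q - r).
Proof.
by move=> hq hr; rewrite -scaleN1r; apply: poly_inD => //; exact: poly_inZ.
Qed.

Lemma poly_inM V q r : poly_in V q -> poly_in V r -> poly_in V (q * r).
Proof.
move=> hq hr mo /msuppM_le /allpairsP[[m1 m2] /= [m1q m2r ->]] i.
rewrite mnmDE addn_eq0 negb_and => /orP[]; [exact: hq | exact: hr].
Qed.

Lemma poly_inX V q k : poly_in V q -> poly_in V (q ^+ k).
Proof.
move=> hq; elim: k => [|k IH]; first by rewrite expr0; exact: poly_in1.
by rewrite exprS; apply: poly_inM.
Qed.

Lemma poly_in_var V i : i \in V -> poly_in V ('X_i : {mpoly R[N]}).
Proof.
move=> iV mo; rewrite msuppX inE => /eqP -> j; rewrite mnm1E.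
by case: (eqVneq i j) => [<-|].
Qed.

Lemma poly_in_sum V (I : Type) (s : seq I) (P : pred I) (F : I -> {mpoly R[N]}) :
  (forall i, P i -> poly_in V (F i)) -> poly_in V (\sum_(i <- s | P i) F i).
Proof.
by move=> hF; apply: (big_ind (poly_in V)) => //;
  [exact: poly_in0 | move=> *; exact: poly_inD].
Qed.

Lemma poly_in_prod V (I : Type) (s : seq I) (P : pred I) (F : I -> {mpoly R[N]}) :
  (forall i, P i -> poly_in V (F i)) -> poly_in V (\prod_(i <- s | P i) F i).
Proof.
by move=> hF; apply: (big_ind (poly_in V)) => //;
  [exact: poly_in1 | move=> *; exact: poly_inM].
Qed.

Lemma poly_in_comp n (U : {set 'I_n}) V (q : {mpoly R[n]})
    (lq : n.-tuple {mpoly R[N]}) :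
  poly_in U q -> (forall i, i \in U -> poly_in V (tnth lq i)) ->
  poly_in V (q \mPo lq).
Proof.
move=> hq hlq; rewrite comp_mpolyE big_seq; apply: poly_in_sum => mo /hq moU.
apply: poly_inZ; apply: poly_in_prod => i _.
have [->|/moU iU] := eqVneq (mo i) 0%N; first by rewrite expr0; exact: poly_in1.
by apply: poly_inX; exact: hlq.
Qed.

End PolyIn.

(** * Sums of squares modulo an ideal *)

Section Cone.
Variables (R : realType) (N : nat) (V : {set 'I_N}).
Implicit Types (q r t : {mpoly R[N]}).

Lemma sos0 : sos V (0 : {mpoly R[N]}).
Proof. by exists [::]; split => //; rewrite big_nil. Qed.

Lemma sosD q r : sos V q -> sos V r -> sos V (q + r).
Proof.
move=> [s [hs ->]] [t [ht ->]]; exists (s ++ t); split; last by rewrite big_cat.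
by move=> h; rewrite mem_cat => /orP[/hs|/ht].
Qed.

Lemma sos_sum (I : Type) (s : seq I) (P : pred I) (F : I -> {mpoly R[N]}) :
  (forall i, P i -> sos V (F i)) -> sos V (\sum_(i <- s | P i) F i).
Proof.
by move=> hF; apply: (big_ind (sos V)) => //; [exact: sos0 | exact: sosD].
Qed.

Lemma sos_sqr q : poly_in V q -> sos V (q ^+ 2).
Proof.
by move=> hq; exists [:: q]; split; rewrite ?big_seq1 // => h; rewrite inE => /eqP ->.
Qed.

Lemma sosM q r : sos V q -> sos V r -> sos V (q * r).
Proof.
move=> [s [hs ->]] [t [ht ->]]; rewrite big_distrlr /= big_seq.
apply: sos_sum => h /hs hV; rewrite big_seq; apply: sos_sum => k /ht kV.
by rewrite -exprMn; apply: sos_sqr; exact: poly_inM.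
Qed.

Lemma sosZ (c : R) q : 0 <= c -> sos V q -> sos V (c *: q).
Proof.
move=> c0 hq; rewrite -mul_mpolyC -(sqr_sqrtr c0) rmorphXn /=.
apply: sosM => //; apply: sos_sqr; rewrite -[_%:MP]mulr1 mul_mpolyC.
by apply: poly_inZ; exact: poly_in1.
Qed.

Lemma sos_poly_in q : sos V q -> poly_in V q.
Proof.
move=> [s [hs ->]]; rewrite big_seq; apply: poly_in_sum => h /hs.
exact: poly_inX.
Qed.

(** The preimage in R[V] of the sums of squares of the quotient R[V]/(t). *)
Definition sos_mod t q : Prop :=
  exists2 s, sos V s & exists2 u, poly_in V u & q = s + u * t.

Variable t : {mpoly R[N]}.
Hypothesis tV : poly_in V t.

Lemma sos_mod_sos q : sos V q -> sos_mod t q.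
Proof.
by exists q => //; exists 0; rewrite ?mul0r ?addr0 //; exact: poly_in0.
Qed.

Lemma sos_modD q r : sos_mod t q -> sos_mod t r -> sos_mod t (q + r).
Proof.
move=> [s hs [u hu ->]] [s' hs' [u' hu' ->]]; exists (s + s'); first exact: sosD.
by exists (u + u'); [exact: poly_inD | rewrite mulrDl addrACA].
Qed.

Lemma sos_modZ (c : R) q : 0 <= c -> sos_mod t q -> sos_mod t (c *: q).
Proof.
move=> c0 [s hs [u hu ->]]; exists (c *: s); first exact: sosZ.
by exists (c *: u); [exact: poly_inZ | rewrite scalerDr scalerAl].
Qed.

Lemma sos_modM q r : sos_mod t q -> sos_mod t r -> sos_mod t (q * r).
Proof.
move=> [s hs [u hu ->]] [s' hs' [u' hu' ->]]; exists (s * s'); first exact: sosM.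
exists (s * u' + u * s' + u * u' * t); last by ring.
have := sos_poly_in hs; have := sos_poly_in hs' => sV s'V.
by do ![apply: poly_inD | apply: poly_inM | by []].
Qed.

Lemma sos_mod1 : sos_mod t 1.
Proof. by apply: sos_mod_sos; rewrite -(expr1n _ 2); apply: sos_sqr; exact: poly_in1. Qed.

Lemma sos_modX q k : sos_mod t q -> sos_mod t (q ^+ k).
Proof.
move=> hq; elim: k => [|k IH]; first exact: sos_mod1.
by rewrite exprS; apply: sos_modM.
Qed.

Lemma sos_mod_sum (I : Type) (s : seq I) (P : pred I) (F : I -> {mpoly R[N]}) :
  (forall i, P i -> sos_mod t (F i)) -> sos_mod t (\sum_(i <- s | P i) F i).
Proof.
move=> hF; apply: (big_ind (sos_mod t)) => //; last exact: sos_modD.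
exact/sos_mod_sos/sos0.
Qed.

Lemma sos_mod_prod (I : Type) (s : seq I) (P : pred I) (F : I -> {mpoly R[N]}) :
  (forall i, P i -> sos_mod t (F i)) -> sos_mod t (\prod_(i <- s | P i) F i).
Proof.
by move=> hF; apply: (big_ind (sos_mod t)) => //; [exact: sos_mod1 | exact: sos_modM].
Qed.

End Cone.

(** * Redistribution of local functions on a finite grid *)

Section Redistribution.
Variables (R : realDomainType) (I T : finType).
Implicit Types (V Z : {set I}) (b c : {ffun I -> T} -> R).

Definition agree_on V (x y : {ffun I -> T}) : bool := [forall i in V, x i == y i].

Definition local_on V b : Prop := forall x y, agree_on V x y -> b x = b y.

Lemma agree_onP V (x y : {ffun I -> T}) : reflect {in V, x =1 y} (agree_on V x y).
Proof. by apply: (iffP forall_inP) => h i /h /eqP. Qed.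

Lemma local_onS V Z b : V \subset Z -> local_on V b -> local_on Z b.
Proof.
move=> sVZ hb x y /agree_onP xy; apply: hb; apply/agree_onP => i iV.
by apply: xy; apply: (fintype.subsetP sVZ).
Qed.

Lemma fibre_min Z c : exists2 phi, local_on Z phi &
  (forall x, phi x <= c x) /\
  (forall x, exists2 y, agree_on Z x y & phi x = c y).
Proof.
have agree_refl x : agree_on Z x x by apply/agree_onP.
pose phi x := c [arg min_(y < x | agree_on Z x y) c y]%O.
have phiE x : exists2 y, agree_on Z x y & phi x = c y.
  by rewrite /phi; case: arg_minP => // y; exists y.
have phi_le x y : agree_on Z x y -> phi x <= c y.
  by rewrite /phi; case: arg_minP => // z _ hz /hz.
exists phi; last by split=> // x; exact: phi_le.
suff le_phi x y : agree_on Z x y -> phi x <= phi y.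
  move=> x y xy; apply/eqP; rewrite eq_le !le_phi //.
  by apply/agree_onP => i /(agree_onP _ _ _ xy).
move=> /agree_onP xy; have [z /agree_onP yz ->] := phiE y.
by apply: phi_le; apply/agree_onP => i iZ; rewrite xy // yz.
Qed.

Variables (p : nat) (V : 'I_p -> {set I}).
Hypothesis rip : forall k : 'I_p, (0 < k)%N ->
  exists2 s : 'I_p, (s < k)%N
    & V k :&: (\bigcup_(j < p | (j < k)%N) V j)%SET \subset V s.

(** The last block hands the minimum of its function over the fibres above the
    separator to an earlier block that contains the separator.  What it keeps
    is nonnegative, and the earlier blocks again have a nonnegative sum, because
    a grid point of the earlier blocks and a minimizer in the last block glue
    to a single grid point. *)
Lemma redistribute (b : 'I_p -> {ffun I -> T} -> R) :
  (forall l, local_on (V l) (b l)) -> (forall x, 0 <= \sum_(l < p) b l x) ->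
  exists b' : 'I_p -> {ffun I -> T} -> R,
    [/\ forall l, local_on (V l) (b' l), forall l x, 0 <= b' l x
      & forall x, \sum_(l < p) b' l x = \sum_(l < p) b l x].
Proof.
suff main r : (r <= p)%N -> forall c : 'I_p -> {ffun I -> T} -> R,
    (forall l, local_on (V l) (c l)) ->
    (forall x, 0 <= \sum_(l < p | (l < r)%N) c l x) ->
    exists c' : 'I_p -> {ffun I -> T} -> R,
    [/\ forall l, local_on (V l) (c' l),
        forall l : 'I_p, (l < r)%N -> forall x, 0 <= c' l x
      & forall x, \sum_(l < p | (l < r)%N) c' l x
                  = \sum_(l < p | (l < r)%N) c l x].
  have sumE (c : 'I_p -> {ffun I -> T} -> R) x :
      \sum_(l < p | (l < p)%N) c l x = \sum_(l < p) c l x.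
    by apply: eq_bigl => l; rewrite ltn_ord.
  move=> bV b0; have [|b' [b'V b'0 b'E]] := main p (leqnn p) b bV.
    by move=> x; rewrite sumE.
  exists b'; split=> // [l x|x]; first exact: b'0.
  by rewrite -sumE b'E sumE.
elim: r => [|r IH] rp c cV c0.
  by exists c; split.
pose k : 'I_p := Ordinal rp.
have sumS (d : 'I_p -> {ffun I -> T} -> R) x :
    \sum_(l < p | (l < r.+1)%N) d l x = d k x + \sum_(l < p | (l < r)%N) d l x.
  rewrite (bigD1 k) //=; congr (_ + _); apply: eq_bigl => l.
  by rewrite ltnS -val_eqE /= [RHS]ltn_neqAle andbC.
have [r0|r_gt0] := posnP r.
  have sum0 (d : 'I_p -> {ffun I -> T} -> R) x :
      \sum_(l < p | (l < r.+1)%N) d l x = d k x.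
    by rewrite sumS big_pred0 ?addr0 // => l; rewrite r0.
  exists c; split=> // l; rewrite r0 ltnS leqn0 => /eqP l0 x.
  suff -> : l = k by rewrite -sum0.
  by apply/val_inj; rewrite /= l0 r0.
have [s sk subs] := rip (k := k) r_gt0.
pose Z := V k :&: (\bigcup_(j < p | (j < r)%N) V j)%SET.
have [phi phiZ [phi_le phiE]] := fibre_min Z (c k).
have neq_sk : (s == k) = false by apply/eqP => sE; rewrite sE ltnn in sk.
pose c1 l x := if l == s then c s x + phi x else c l x.
have c1sum x : \sum_(l < p | (l < r)%N) c1 l x
    = phi x + \sum_(l < p | (l < r)%N) c l x.
  rewrite !(bigD1 (P := fun l : 'I_p => (l < r)%N) s) //= {1}/c1 eqxx.
  rewrite addrA [phi x + _]addrC; congr (_ + _).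
  by apply: eq_bigr => l /andP[_ /negbTE ls]; rewrite /c1 ls.
have c1V l : local_on (V l) (c1 l).
  rewrite /c1; case: eqP => [->|_]; last exact: cV.
  by move=> x y xy; rewrite (cV _ _ _ xy) (local_onS subs phiZ xy).
have [|c2 [c2V c20 c2E]] := IH (ltnW rp) c1 c1V.
  move=> x; rewrite c1sum; have [y /agree_onP xy ->] := phiE x.
  (* the glued point: x on the earlier blocks, the minimizer y elsewhere *)
  pose z : {ffun I -> T} :=
    [ffun i => if i \in (\bigcup_(j < p | (j < r)%N) V j)%SET then x i else y i].
  have -> : c k y = c k z.
    apply: cV; apply/agree_onP => i iV; rewrite ffunE; case: ifP => // iU.
    by rewrite xy // inE iV.
  have -> : \sum_(l < p | (l < r)%N) c l x = \sum_(l < p | (l < r)%N) c l z.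
    apply: eq_bigr => l lr; apply: cV; apply/agree_onP => i iV.
    by rewrite ffunE ifT //; apply/bigcupP; exists l.
  by rewrite -sumS.
pose c3 l x := if l == k then c k x - phi x else c2 l x.
exists c3; split.
- move=> l; rewrite /c3; case: eqP => [->|_]; last exact: c2V.
  move=> x y xy; rewrite (cV _ _ _ xy); congr (_ - _).
  by apply: (local_onS _ phiZ) xy; exact: finset.subsetIl.
- move=> l lr x; rewrite /c3; case: eqP => [_|lk]; first by rewrite subr_ge0.
  apply: c20; rewrite ltn_neqAle -ltnS lr andbT; apply/eqP => lE.
  by apply: lk; apply/val_inj.
- move=> x; rewrite !sumS {1}/c3 eqxx.
  rewrite (eq_bigr (fun l => c2 l x)); last first.
    by move=> l lr; rewrite /c3; case: eqP => // lk; rewrite lk ltnn in lr.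
  by rewrite c2E c1sum addrA subrK.
Qed.

End Redistribution.

(** * Bernstein polynomials *)

Section Bernstein.
Variables (R : realType) (A : comAlgType R) (k : nat).
Implicit Types (z : A).

Definition bernstein (i : nat) z : A := z ^+ i * (1 - z) ^+ (k - i) *+ 'C(k, i).

Lemma bernstein_sum z : \sum_(i < k.+1) bernstein i z = 1.
Proof.
rewrite -(expr1n _ k) -[X in X ^+ k](subrK z) exprDn.
by apply: eq_bigr => i _; rewrite mulrC.
Qed.

Lemma mul_bin_bin i a : (a <= i <= k)%N ->
  ('C(k, i) * 'C(i, a) = 'C(k, a) * 'C(k - a, i - a))%N.
Proof.
move=> /andP[ai ik]; have ak := leq_trans ai ik.
apply/eqP; rewrite -(eqn_pmul2r (m := a`! * (i - a)`! * (k - i)`!)) ?muln_gt0 ?fact_gt0 //.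
have e1 := bin_fact ai; have e2 := bin_fact ik; have e3 := bin_fact ak.
have e4 : ('C(k - a, i - a) * ((i - a)`! * (k - i)`!))%N = (k - a)`!.
  by rewrite -(bin_fact (leq_sub2r a ik)) subnBA // subnK.
apply/eqP; transitivity k`!; first by rewrite -e2 -e1; ring.
by rewrite -e3 -e4; ring.
Qed.

(** Expand the factor 1 = (z + (1 - z)) ^ (k - a) of the monomial z ^ a. *)
Lemma bernstein_monomial a z : (a <= k)%N ->
  \sum_(i < k.+1) ('C(i, a)%:R / 'C(k, a)%:R : R) *: bernstein i z = z ^+ a.
Proof.
move=> ak; have kE : k.+1 = (a + (k - a).+1)%N by rewrite addnS subnKC.
rewrite -(big_mkord xpredT
  (fun i => ('C(i, a)%:R / 'C(k, a)%:R : R) *: bernstein i z)).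
rewrite (big_cat_nat (n := a)) //=; last exact: leqW.
rewrite big_nat_cond big1 ?add0r; last first.
  by move=> i /andP[/andP[_ ia] _]; rewrite bin_small // mul0r scale0r.
rewrite -{1}(add0n a) big_addn subSn // big_mkord.
have -> : z ^+ a = z ^+ a * (1 - z + z) ^+ (k - a) by rewrite subrK expr1n mulr1.
rewrite exprDn mulr_sumr.
apply: eq_bigr => -[i /= ik] _; rewrite ltnS in ik.
have iak : (i + a <= k)%N by rewrite -(subnK ak) leq_add2r.
have scale_muln (c : R) (w : A) j : c *: (w *+ j) = (c * j%:R) *: w.
  by rewrite -scalerA scaler_nat.
rewrite /bernstein scale_muln.
have -> : 'C(i + a, a)%:R / 'C(k, a)%:R * 'C(k, i + a)%:R = 'C(k - a, i)%:R :> R.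
  rewrite mulrAC -natrM mulnC mul_bin_bin ?leq_addl // addnK natrM.
  by rewrite mulrC mulKf // pnatr_eq0 -lt0n bin_gt0.
rewrite scaler_nat mulrnAr; congr (_ *+ _).
by rewrite addnC exprD subnDA -mulrA; congr (_ * _); rewrite mulrC.
Qed.

End Bernstein.

Section BernsteinOperator.
Variables (R : realType) (N : nat).
Local Notation grid k := {ffun 'I_N -> 'I_k.+1}.
Implicit Types (q t : {mpoly R[N]}) (V : {set 'I_N}).

Definition bernstein_op k (y : 'I_N -> {mpoly R[N]}) (b : grid k -> R) : {mpoly R[N]} :=
  \sum_(x : grid k) b x *: \prod_(i < N) bernstein k (x i) (y i).

(** The coefficients of [q] in the Bernstein basis of degree [k] in each variable. *)
Definition bernstein_coef k q (x : grid k) : R :=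
  \sum_(mo <- msupp q) q@_mo * \prod_(i < N) ('C(x i, mo i)%:R / 'C(k, mo i)%:R).

Lemma bernstein_op_sum k y (I : Type) (s : seq I) (b : I -> grid k -> R) :
  bernstein_op y (fun x => \sum_(l <- s) b l x) = \sum_(l <- s) bernstein_op y (b l).
Proof.
rewrite exchange_big; apply: eq_bigr => x _ /=.
by rewrite scaler_suml.
Qed.

(** Monomial by monomial, this is the one-variable identity in each factor. *)
Lemma bernstein_coefP k y q : (msize q <= k)%N ->
  bernstein_op y (@bernstein_coef k q) = q \mPo [tuple y i | i < N].
Proof.
move=> qk; rewrite comp_mpolyE bernstein_op_sum big_seq [RHS]big_seq.
apply: eq_bigr => mo moq; rewrite /bernstein_op.
under eq_bigr => x _ do rewrite -scalerA.
rewrite -scaler_sumr; congr (_ *: _).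
under eq_bigr => x _ do rewrite -scaler_prod.
rewrite -(bigA_distr_bigA (fun i (j : 'I_k.+1) =>
  ('C(j, mo i)%:R / 'C(k, mo i)%:R : R) *: bernstein k j (y i))).
apply: eq_bigr => i _; rewrite tnth_mktuple; apply: bernstein_monomial.
apply: leq_trans qk; apply: ltnW; apply: leq_ltn_trans (msize_mdeg_lt moq).
by rewrite mdegE (bigD1 i) //= leq_addr.
Qed.

Lemma bernstein_coef_local k V q :
  poly_in V q -> local_on V (@bernstein_coef k q).
Proof.
move=> qV x y /agree_onP xy; rewrite /bernstein_coef !big_seq.
apply: eq_bigr => mo /qV moV; congr (_ * _); apply: eq_bigr => i _.
by have [->|/moV iV] := eqVneq (mo i) 0%N; [rewrite !bin0 | rewrite xy].
Qed.

(** The variables outside [V] disappear since the Bernstein polynomials in each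
    of them sum to 1. *)
Lemma bernstein_op_local k y V (b : grid k -> R) : local_on V b ->
  bernstein_op y b = \sum_(x : grid k | [forall i in ~: V, x i == ord0])
    b x *: \prod_(i in V) bernstein k (x i) (y i).
Proof.
move=> bV; pose res (x : grid k) : grid k := [ffun i => if i \in V then x i else ord0].
pose Q (x : grid k) := [forall i in ~: V, x i == ord0].
rewrite /bernstein_op (partition_big res Q) => [|x _]; last first.
  by apply/forall_inP => i; rewrite inE ffunE => /negbTE ->.
apply: eq_bigr => z /forall_inP zQ.
rewrite (eq_bigr (fun x : grid k => b z *: \prod_(i < N) bernstein k (x i) (y i))); last first.
  move=> x /= /eqP <-; congr (_ *: _); apply: bV; apply/agree_onP => i iV.
  by rewrite ffunE iV.
rewrite -scaler_sumr; congr (_ *: _).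
pose P (i : 'I_N) : pred 'I_k.+1 := fun j => (i \in V) ==> (j == z i).
rewrite (eq_bigl (fun x : grid k => x \in pfamily ord0 predT P)); last first.
  move=> x /=; apply/eqP/pfamilyP => [xz|[_ xP]].
    split=> [|i _]; first by apply/fintype.subsetP.
    by rewrite unfold_in /P -xz ffunE; apply/implyP => ->.
  apply/ffunP => i; rewrite ffunE; case: ifPn => iV; last first.
    by apply/esym/eqP/zQ; rewrite inE.
  by have := xP i isT; rewrite unfold_in /P iV => /eqP.
rewrite -(big_distr_big_dep _ _ _ (fun i (j : 'I_k.+1) => bernstein k j (y i))).
rewrite [RHS]big_mkcond /=; apply: eq_bigr => i _; rewrite /P; case: ifP => iV /=.
  by rewrite big_pred1_eq.
exact: bernstein_sum.
Qed.

Lemma sos_mod_bernstein_op k y V t (b : grid k -> R) :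
  poly_in V t -> local_on V b -> (forall x, 0 <= b x) ->
  (forall i, i \in V -> sos_mod V t (y i) /\ sos_mod V t (1 - y i)) ->
  sos_mod V t (bernstein_op y b).
Proof.
move=> tV bV b0 yV; rewrite (bernstein_op_local _ bV); apply: sos_mod_sum => x _.
apply: sos_modZ => //; apply: sos_mod_prod => // i /yV[y1 y2].
rewrite /bernstein -scaler_nat; apply: sos_modZ => //.
by apply: sos_modM => //; apply: sos_modX.
Qed.

End BernsteinOperator.

(** * Convergence of the Bernstein coefficients *)

Section BernsteinConvergence.
Variables (R : realType) (N : nat).
Local Notation grid k := {ffun 'I_N -> 'I_k.+1}.

(** Pointwise error O(1/k), uniformly on the grid of mesh 1/k. *)
Definition mesh_close (F G : forall k, grid k -> R) : Prop :=
  exists2 C, 0 <= C & forall k (x : grid k), (0 < k)%N -> `|F k x - G k x| <= C / k%:R.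

Lemma mesh_close_sum (I : Type) (s : seq I) (F G : I -> forall k, grid k -> R) :
  (forall i, mesh_close (F i) (G i)) ->
  mesh_close (fun k x => \sum_(i <- s) F i k x) (fun k x => \sum_(i <- s) G i k x).
Proof.
move=> FG; elim: s => [|i s [C C0 hC]].
  by exists 0 => // k x _; rewrite !big_nil subrr normr0 mul0r.
have [D D0 hD] := FG i; exists (D + C); first exact: addr_ge0.
move=> k x k0; rewrite !big_cons opprD addrACA mulrDl.
by rewrite (le_trans (ler_normD _ _)) // lerD ?hC ?hD.
Qed.

Lemma mesh_closeZ (c : R) (F G : forall k, grid k -> R) : mesh_close F G ->
  mesh_close (fun k x => c * F k x) (fun k x => c * G k x).
Proof.
move=> [C C0 hC]; exists (`|c| * C); first exact: mulr_ge0.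
by move=> k x k0; rewrite -mulrBr normrM -mulrA ler_wpM2l // hC.
Qed.

Lemma mesh_closeM (F G F' G' : forall k, grid k -> R) :
  (forall k (x : grid k), (0 < k)%N -> `|F k x| <= 1 /\ `|G' k x| <= 1) ->
  mesh_close F G -> mesh_close F' G' ->
  mesh_close (fun k x => F k x * F' k x) (fun k x => G k x * G' k x).
Proof.
move=> h1 [C C0 hC] [D D0 hD]; exists (C + D); first exact: addr_ge0.
move=> k x k0; have [F1 G1] := h1 k x k0.
have -> : F k x * F' k x - G k x * G' k x
        = (F k x - G k x) * G' k x + F k x * (F' k x - G' k x) by ring.
rewrite [(C + D) / _]mulrDl (le_trans (ler_normD _ _)) // !normrM lerD //.
  by rewrite (le_trans _ (hC k x k0)) // ler_piMr.
by rewrite (le_trans _ (hD k x k0)) // ler_piMl.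
Qed.

Lemma bin_ratio_itv k i a : (i <= k)%N -> 0 <= ('C(i, a)%:R / 'C(k, a)%:R : R) <= 1.
Proof.
move=> ik; rewrite divr_ge0 //=.
have [->|/negbTE nz] := eqVneq 'C(k, a) 0%N; first by rewrite invr0 mulr0.
by rewrite ler_pdivrMr ?ltr0n ?lt0n ?nz // mul1r ler_nat leq_bin2l.
Qed.

Lemma mesh_point_itv k i : (i <= k)%N -> 0 <= (i%:R / k%:R : R) <= 1.
Proof.
move=> ik; rewrite divr_ge0 //=; case: k ik => [|k] ik; first by rewrite invr0 mulr0.
by rewrite ler_pdivrMr // mul1r ler_nat.
Qed.

(** Raising [a] by 1 multiplies the left-hand side by [(x i - a) / (k - a)], which
    tends to [x i / k] at rate [1 / k]; truncated subtraction makes this hold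
    in the degenerate cases [x i < a] and [k <= a] too. *)
Lemma bin_ratio_close i a :
  mesh_close (fun k (x : grid k) => 'C(x i, a)%:R / 'C(k, a)%:R)
             (fun k x => ((x i)%:R / k%:R) ^+ a).
Proof.
have xk k (x : grid k) : (x i <= k)%N by rewrite -ltnS.
elim: a => [|a IH].
  by exists 0 => // k x k0; rewrite !bin0 divr1 subrr normr0 mul0r.
suff [C C0 hC] : mesh_close
    (fun k (x : grid k) => (x i - a)%:R / (k - a)%:R) (fun k x => (x i)%:R / k%:R).
  have binS k j : 'C(j, a.+1)%:R / 'C(k, a.+1)%:R
      = ('C(j, a)%:R / 'C(k, a)%:R) * ((j - a)%:R / (k - a)%:R) :> R.
    have S0 : a.+1%:R != 0 :> R by rewrite pnatr_eq0.
    have binE m : 'C(m, a.+1)%:R = (m - a)%:R * 'C(m, a)%:R / a.+1%:R :> R.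
      by rewrite -natrM -mul_bin_left natrM mulrAC mulfV // mul1r.
    by rewrite !binE -!mulf_div divff ?invr_eq0 // mulr1 mulrC.
  have := mesh_closeM _ IH (ex_intro2 _ _ C C0 hC).
  move=> /(_ _) [|D D0 hD].
    move=> k x k0; have /andP[? ?] := bin_ratio_itv a (xk k x).
    by have /andP[? ?] := mesh_point_itv (xk k x); rewrite !ger0_norm.
  exists D => // k x k0; rewrite binS exprSr; exact: hD.
exists (a * a.+1)%:R => // k x k0; have := xk k x; move: (nat_of_ord (x i)) => j jk.
have k0R : 0 < k%:R :> R by rewrite ltr0n.
have [ka|ak] := leqP k a.
  have /andP[p0 p1] := mesh_point_itv jk.
  have -> : (k - a = 0)%N by apply/eqP; rewrite subn_eq0.
  rewrite invr0 mulr0 sub0r normrN ger0_norm // (le_trans p1) //.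
  rewrite ler_pdivlMr // mul1r ler_nat (leq_trans ka) // leq_pmulr //.
have ka0 : 0 < (k - a)%:R :> R by rewrite ltr0n subn_gt0.
have kaE : (k - a)%:R = k%:R - a%:R :> R by rewrite natrB // ltnW.
have ak1 : 1 <= k%:R - a%:R :> R by rewrite -kaE ler1n subn_gt0.
have a0 : 0 <= a%:R :> R by [].
have jkR : j%:R <= k%:R :> R by rewrite ler_nat.
rewrite natrM -natr1.
have [aj|ja] := leqP a j.
  rewrite natrB // kaE ler_norml; apply/andP; split.
    rewrite -subr_ge0.
    have -> : (j%:R - a%:R) / (k%:R - a%:R) - j%:R / k%:R
        - - (a%:R * (a%:R + 1) / k%:R)
        = (a%:R * (a%:R * (k%:R - a%:R - 1) + j%:R)) / ((k%:R - a%:R) * k%:R) :> R.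
      by field; rewrite !gt_eqF // -?kaE.
    apply: divr_ge0; last by apply: mulr_ge0 => //; lra.
    by apply: mulr_ge0 => //; apply: addr_ge0 => //; apply: mulr_ge0 => //; lra.
  apply: (@le_trans _ _ 0); last by apply: divr_ge0 => //; apply: mulr_ge0 => //; apply: addr_ge0.
  have -> : (j%:R - a%:R) / (k%:R - a%:R) - j%:R / k%:R
      = - (a%:R * (k%:R - j%:R)) / ((k%:R - a%:R) * k%:R) :> R.
    by field; rewrite !gt_eqF // -?kaE.
  by rewrite mulNr oppr_le0; apply: divr_ge0; apply: mulr_ge0 => //; lra.
have -> : (j - a = 0)%N by apply/eqP; rewrite subn_eq0 ltnW.
rewrite mul0r sub0r normrN ger0_norm ?divr_ge0 // ler_pM2r ?invr_gt0 //.
have : j%:R <= a%:R :> R by rewrite ler_nat ltnW.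
by move: (j%:R) (a%:R) a0 => u v v0 uv; nra.
Qed.

Lemma bernstein_coef_close (q : {mpoly R[N]}) :
  mesh_close (fun k => @bernstein_coef R N k q)
             (fun k x => q.@[fun i => (x i)%:R / k%:R]).
Proof.
have xk k (x : grid k) i : (x i <= k)%N by rewrite -ltnS.
pose F mo k (x : grid k) : R := q@_mo * \prod_(i < N) ('C(x i, mo i)%:R / 'C(k, mo i)%:R).
pose G mo k (x : grid k) : R := q@_mo * \prod_(i < N) ((x i)%:R / k%:R) ^+ mo i.
suff [C C0 hC] : mesh_close (fun k x => \sum_(mo <- msupp q) F mo k x)
                   (fun k x => \sum_(mo <- msupp q) G mo k x).
  by exists C => // k x k0; rewrite mevalE; exact: hC.
apply: mesh_close_sum => mo; apply: mesh_closeZ.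
elim: (index_enum _) => [|i s IH].
  by exists 0 => // k x _; rewrite !big_nil subrr normr0 mul0r.
have [|C C0 hC] := mesh_closeM _ (bin_ratio_close i (mo i)) IH.
  move=> k x k0; have /andP[b0 b1] := bin_ratio_itv (mo i) (xk k x i).
  have p01 j : 0 <= ((x j)%:R / k%:R : R) ^+ mo j <= 1.
    have /andP[p0 p1] := mesh_point_itv (xk k x j).
    by rewrite exprn_ge0 //= exprn_ile1.
  have q0 : 0 <= \prod_(j <- s) ((x j)%:R / k%:R) ^+ mo j :> R.
    by apply: prodr_ge0 => j _; case/andP: (p01 j).
  by rewrite !ger0_norm // prodr_ile1.
by exists C => // k x k0; rewrite !big_cons; exact: hC.
Qed.

End BernsteinConvergence.

(** * Polynomials positive on a box, with sparsity *)

Section SparseBox.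
Variables (R : realType) (N p : nat) (V : 'I_p -> {set 'I_N}).
Variable t : 'I_p -> {mpoly R[N]}.
Local Notation grid k := {ffun 'I_N -> 'I_k.+1}.

Hypothesis rip : running_intersection V.
Hypothesis tV : forall l, poly_in (V l) (t l).
Hypothesis sos_vars : forall l i, i \in V l ->
  sos_mod (V l) (t l) (1 + 'X_i) /\ sos_mod (V l) (t l) (1 - 'X_i).

(* The affine changes of coordinates between [-1, 1]^N and [0, 1]^N. *)
Let to_unit : N.-tuple {mpoly R[N]} := [tuple 2%:R *: 'X_i - 1 | i < N].
Let of_unit : N.-tuple {mpoly R[N]} := [tuple 2%:R^-1 *: (1 + 'X_i) | i < N].

Lemma to_unitK (h : {mpoly R[N]}) : (h \mPo to_unit) \mPo of_unit = h.
Proof.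
rewrite [h \mPo _]comp_mpolyE raddf_sum /= [RHS]mpolyE; apply: eq_bigr => mo _.
rewrite comp_mpolyZ; congr (_ *: _).
rewrite -[RHS](comp_mpoly_id 'X_[mo]) comp_mpolyX.
rewrite (rmorph_prod (comp_mpoly of_unit)); apply: eq_bigr => i _.
rewrite rmorphXn /= !tnth_mktuple comp_mpolyB comp_mpolyZ comp_mpoly1.
rewrite comp_mpolyXU -tnth_nth tnth_mktuple scalerA divff ?pnatr_eq0 // scale1r.
by rewrite addrC addKr.
Qed.

(** Over a fine grid the Bernstein coefficients of the sum of the blocks are close to
    its values, hence nonnegative.  Those of each block depend on the variables
    of that block only, so they can be redistributed into nonnegative ones. *)
Theorem sparse_positive_on_box (h : 'I_p -> {mpoly R[N]}) (c : R) :
  (forall l, poly_in (V l) (h l)) -> 0 < c ->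
  (forall y : 'rV[R]_N, (forall i, -1 <= y ord0 i <= 1) ->
     c <= (\sum_(l < p) h l).@[y ord0]) ->
  exists2 r : 'I_p -> {mpoly R[N]},
    forall l, sos_mod (V l) (t l) (r l) & \sum_(l < p) h l = \sum_(l < p) r l.
Proof.
move=> hV c0 hc; pose q l := h l \mPo to_unit.
have qV l : poly_in (V l) (q l).
  apply: poly_in_comp (hV l) _ => i iV; rewrite tnth_mktuple.
  by apply: poly_inB; [apply/poly_inZ/poly_in_var | exact: poly_in1].
have [C C0 hC] : mesh_close
    (fun k x => \sum_(l < p) @bernstein_coef R N k (q l) x)
    (fun k x => \sum_(l < p) (q l).@[fun i => (x i)%:R / k%:R]).
  by apply: mesh_close_sum => l; exact: bernstein_coef_close.
pose k := (\sum_(l < p) msize (q l) + (Num.truncn (C / c)).+1)%N.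
have k0 : (0 < k)%N by rewrite /k addnS.
have Ck : C / k%:R <= c.
  rewrite ler_pdivrMr ?ltr0n // mulrC -ler_pdivrMr //.
  by rewrite ltW // (lt_le_trans (truncnS_gt _)) // ler_nat leq_addl.
have [x|b [bV b0 bE]] := redistribute rip (b := fun l => @bernstein_coef R N k (q l))
    (fun l => bernstein_coef_local (qV l)).
  have := hC k x k0; rewrite ler_distl => /andP[+ _]; apply: le_trans.
  rewrite subr_ge0 (le_trans Ck) //.
  pose y : 'rV[R]_N := \row_i (2%:R * ((x i)%:R / k%:R) - 1).
  have yE : \sum_(l < p) (q l).@[fun i => (x i)%:R / k%:R]
      = (\sum_(l < p) h l).@[y ord0].
    rewrite raddf_sum /=; apply: eq_bigr => l _; rewrite comp_mpoly_meval.
    by apply: meval_eq => i; rewrite tnth_mktuple mevalB mevalZ mevalXU meval1 mxE.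
  rewrite yE; apply: hc => i; rewrite mxE.
  have xk : (x i <= k)%N by rewrite -ltnS.
  have /andP[z0 z1] := mesh_point_itv R xk.
  by apply/andP; split; lra.
exists (fun l => bernstein_op (tnth of_unit) (b l)) => [l|].
  apply: sos_mod_bernstein_op => // i iV; rewrite tnth_mktuple.
  have [s1 s2] := sos_vars iV; split; first by apply: sos_modZ; rewrite ?invr_ge0.
  suff -> : 1 - 2%:R^-1 *: (1 + 'X_i) = 2%:R^-1 *: (1 - 'X_i) :> {mpoly R[N]}.
    by apply: sos_modZ; rewrite ?invr_ge0.
  have {1}-> : 1 = 2%:R^-1 *: (1 + 1) :> {mpoly R[N]}.
    by rewrite -[1 + 1]/(2%:R) -(scaler_nat 2 (1 : {mpoly R[N]})) scalerA mulVf ?scale1r ?pnatr_eq0.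
  by rewrite -scalerBr opprD addrA addrK.
rewrite -bernstein_op_sum.
transitivity (bernstein_op (tnth of_unit)
    (fun x => \sum_(l < p) @bernstein_coef R N k (q l) x)); last first.
  by apply: eq_bigr => x _; rewrite bE.
rewrite bernstein_op_sum; apply: eq_bigr => l _; rewrite bernstein_coefP.
  rewrite -[LHS]to_unitK; congr (_ \mPo _).
  by apply: eq_from_tnth => i; rewrite tnth_mktuple.
by rewrite /k (bigD1 l) //= -!addnA leq_addr.
Qed.

End SparseBox.

(** * Penalties on a compact set *)

Section Continuity.
Variables (R : realType).

Lemma continuous_bigD (T : topologicalType) (I : Type) (s : seq I) (F : I -> T -> R) :
  (forall i, continuous (F i)) -> continuous (fun x => \sum_(i <- s) F i x).
Proof. by move=> hF; apply: continuous_big => //; exact: add_continuous. Qed.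

Lemma continuous_meval N (q : {mpoly R[N]}) :
  continuous (fun y : 'rV[R]_N => q.@[y ord0]).
Proof.
have cM (f g : 'rV[R]_N -> R) :
    continuous f -> continuous g -> continuous (fun y => f y * g y).
  by move=> hf hg y; exact: cvgM (hf y) (hg y).
have -> : (fun y : 'rV[R]_N => q.@[y ord0])
    = (fun y => \sum_(mo <- msupp q) q@_mo * \prod_i y ord0 i ^+ mo i).
  by apply/funext => y; rewrite mevalE.
apply: continuous_bigD => mo; apply: (cM); first by exact: cst_continuous.
elim: (index_enum _) => [|i s IH].
  by under eq_fun do rewrite big_nil; exact: cst_continuous.
under eq_fun do rewrite big_cons; apply: (cM) => //.
elim: (mo i) => [|d IHd]; first by under eq_fun do rewrite expr0; exact: cst_continuous.
by under eq_fun do rewrite exprS; apply: (cM) => //; exact: coord_continuous.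
Qed.

(** A continuous function that is positive where a nonnegative penalty vanishes
    becomes uniformly positive once a large multiple of the penalty is added:
    the multiple only matters on the compact set where the function is
    nonpositive, and there the penalty has a positive minimum. *)
Lemma compact_penalty (T : topologicalType) (A : set T) (f pen : T -> R) :
  compact A -> continuous f -> continuous pen ->
  (forall y, A y -> 0 <= pen y) -> (forall y, A y -> pen y = 0 -> 0 < f y) ->
  exists2 lam, 0 <= lam &
    exists2 c, 0 < c & forall y, A y -> c <= f y + lam * pen y.
Proof.
move=> cA cf cpen pen0 fpos.
suff [lam lam0 hlam] : exists2 lam, 0 <= lam & forall y, A y -> 0 < f y + lam * pen y.
  exists lam => //; have [A0|/set0P A0] := eqVneq A classical_sets.set0.
    by exists 1 => // y; rewrite A0.
  have [|z /set_mem zA hz] := compact_EVT_min (f := fun y => f y + lam * pen y) A0 cA.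
    apply: continuous_subspaceT => y; apply: cvgD; first exact: cf.
    by apply: cvgM; [exact: cvg_cst | exact: cpen].
  by exists (f z + lam * pen z) => [|y yA]; [exact: hlam | apply/hz/mem_set].
pose B := A `&` [set y | f y <= 0].
have cB : compact B.
  apply: compact_closedI => //.
  by apply: (closed_comp (f := f) (D := [set x | x <= 0])) => [y _|];
    [exact: cf | exact: closed_le].
have [B0|/set0P B0] := eqVneq B classical_sets.set0.
  exists 0 => // y yA; rewrite mul0r addr0 ltNge; apply/negP => fy.
  by have : B y by []; rewrite B0.
have [|z /set_mem [zA fz] hz] := compact_EVT_min (f := pen) B0 cB.
  exact: continuous_subspaceT.
have [|w /set_mem [wA fw] hw] := compact_EVT_min (f := f) B0 cB.
  exact: continuous_subspaceT.
have pz : 0 < pen z.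
  rewrite lt_neqAle pen0 // andbT eq_sym; apply/eqP => /(fpos _ zA).
  by rewrite ltNge fz.
exists ((1 - f w) / pen z) => [|y yA].
  by rewrite divr_ge0 ?subr_ge0 ?(le_trans fw) // ltW.
have [fy|fy] := leP (f y) 0; last first.
  by rewrite ltr_pwDl // mulr_ge0 ?pen0 // divr_ge0 ?subr_ge0 ?(le_trans fw) // ltW.
have By : y \in B by apply/mem_set.
have : 1 - f w <= (1 - f w) / pen z * pen y.
  rewrite mulrAC ler_pdivlMr // ler_wpM2l ?subr_ge0 ?(le_trans fw) //.
  exact: hz.
by have := hw _ By; lra.
Qed.

End Continuity.

Section SparsePutinar.
Variables (R : realType) (N : nat).

Definition coef_bound (q : {mpoly R[N]}) : R := 1 + \sum_(mo <- msupp q) `|q@_mo|.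

Lemma coef_bound_gt0 q : 0 < coef_bound q.
Proof. by rewrite ltr_pwDl // sumr_ge0. Qed.

Lemma coef_boundP q (y : 'rV[R]_N) :
  (forall i, -1 <= y ord0 i <= 1) -> `|q.@[y ord0] / coef_bound q| <= 1.
Proof.
move=> hy; rewrite normrM normfV [`|coef_bound q|]gtr0_norm ?coef_bound_gt0 //.
rewrite ler_pdivrMr ?coef_bound_gt0 // mul1r mevalE.
rewrite (le_trans (ler_norm_sum _ _ _)) // (le_trans _ (_ : \sum_(mo <- msupp q) `|q@_mo| <= _)) //.
  apply: ler_sum => mo _; rewrite normrM ler_piMr // normr_prod.
  apply: prodr_ile1 => i _; rewrite normr_ge0 /= normrX exprn_ile1 // ler_norml.
  exact: hy.
by rewrite lerDr.
Qed.

(** The polynomial penalty with a square weight which is small where [u] is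
    nonnegative, by Bernoulli's inequality, and at least [- u] elsewhere. *)
Lemma weighted_penalty (u : R) k : `|u| <= 1 -> (0 < k)%N ->
  Num.max (- u) 0 - k%:R^-1 <= - ((1 - u) ^+ k.*2 * u).
Proof.
move=> u1 k0; have k0R : 0 < k%:R :> R by rewrite ltr0n.
have sqge0 : 0 <= (1 - u) ^+ k.*2 by rewrite -mul2n exprM exprn_ge0 // sqr_ge0.
move: u1; rewrite ler_norml => /andP[u_ge u_le].
have [u0|u0] := leP 0 u.
  have -> : Num.max (- u) 0 = 0 by apply/max_idPr; rewrite oppr_le0.
  rewrite sub0r lerN2 -[k%:R^-1]mul1r ler_pdivlMr // -mulrA.
  have bernoulli j : u * j%:R <= (1 + u) ^+ j.
    suff : 1 + u * j%:R <= (1 + u) ^+ j by apply: le_trans; rewrite lerDr.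
    elim: j => [|j IH]; first by rewrite mulr0 addr0.
    rewrite exprS -natr1; apply: le_trans (_ : (1 + u) * (1 + u * j%:R) <= _).
      have : 0 <= u * u * j%:R by rewrite !mulr_ge0.
      by move: (j%:R) => j'; nra.
    by rewrite ler_wpM2l // addr_ge0.
  apply: le_trans (_ : (1 - u) ^+ k.*2 * (1 + u) ^+ k.*2 <= _).
    rewrite ler_wpM2l //; apply: le_trans (bernoulli _).
    by rewrite ler_wpM2l // ler_nat -addnn leq_addr.
  by rewrite -exprMn exprn_ile1 //; nra.
have -> : Num.max (- u) 0 = - u by apply/max_idPl; rewrite oppr_ge0 ltW.
have : 1 <= (1 - u) ^+ k.*2 by apply: exprn_ege1; lra.
have : 0 < k%:R^-1 :> R by rewrite invr_gt0.
by move: (k%:R^-1) ((1 - u) ^+ k.*2) => v w v0 w1; nra.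
Qed.

Variables (p : nat) (V : 'I_p -> {set 'I_N}) (t : 'I_p -> {mpoly R[N]}).
Variable G : 'I_p -> seq {mpoly R[N]}.

Hypothesis rip : running_intersection V.
Hypothesis tV : forall l, poly_in (V l) (t l).
Hypothesis sos_vars : forall l i, i \in V l ->
  sos_mod (V l) (t l) (1 + 'X_i) /\ sos_mod (V l) (t l) (1 - 'X_i).
Hypothesis GV : forall l g, g \in G l -> poly_in (V l) g.

(** After the penalties are added the sum of the blocks is bounded below by [c / 2] on
    the box, so the previous theorem applies; moving the penalties back produces
    the multipliers of the constraints and of the equations [t l = 0]. *)
Theorem sparse_putinar (h : 'I_p -> {mpoly R[N]}) :
  (forall l, poly_in (V l) (h l)) ->
  (forall y : 'rV[R]_N, (forall l g, g \in G l -> 0 <= g.@[y ord0]) ->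
     (forall l, (t l).@[y ord0] = 0) -> 0 < (\sum_(l < p) h l).@[y ord0]) ->
  exists sigma tau : 'I_p -> {mpoly R[N]},
    [/\ forall l, quadratic_module (G l) (V l) (sigma l),
        forall l, poly_in (V l) (tau l)
      & \sum_(l < p) h l = \sum_(l < p) (sigma l + tau l * t l)].
Proof.
move=> hV hpos; pose H := \sum_(l < p) h l.
pose u (q : {mpoly R[N]}) := (coef_bound q)^-1 *: q.
pose pen (y : 'rV[R]_N) := \sum_(l < p)
  (\sum_(g <- G l) Num.max (- (u g).@[y ord0]) 0 + (t l).@[y ord0] ^+ 2).
pose A := [set y : 'rV[R]_N | forall i, `[-1, 1]%classic (y ord0 i)].
have AE y : A y -> forall i, -1 <= y ord0 i <= 1.
  by move=> yA i; have := yA i; rewrite /= in_itv.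
have sum_max_ge0 l y : 0 <= \sum_(g <- G l) Num.max (- (u g).@[y ord0]) 0.
  by apply: sumr_ge0 => g _; rewrite le_max lexx orbT.
have [lam lam0 [c c0 hc]] : exists2 lam, 0 <= lam & exists2 c, 0 < c &
    forall y, A y -> c <= H.@[y ord0] + lam * pen y.
  apply: compact_penalty.
  - by apply: (@rV_compact R N (fun=> `[-1, 1]%classic)) => _; exact: segment_compact.
  - exact: continuous_meval.
  - apply: continuous_bigD => l.
    have pen_l : continuous (fun y : 'rV[R]_N =>
        \sum_(g <- G l) Num.max (- (u g).@[y ord0]) 0).
      apply: continuous_bigD => g y.
      apply: (continuous_max (f := fun z : 'rV[R]_N => - (u g).@[z ord0])).
        exact: (cvgN (@continuous_meval R N (u g) y)).
      exact: cst_continuous.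
    have ct := @continuous_meval R N (t l).
    by move=> y; exact: (cvgD (pen_l y) (cvgM (ct y) (ct y))).
  - move=> y _; apply: sumr_ge0 => l _.
    by apply: addr_ge0; [exact: sum_max_ge0 | exact: sqr_ge0].
  move=> y _ /eqP; rewrite psumr_eq0; last first.
    by move=> l _; apply: addr_ge0; [exact: sum_max_ge0 | exact: sqr_ge0].
  move=> /allP pen0; apply: hpos => l.
    move=> g gG; have := pen0 l (mem_index_enum _).
    rewrite /= paddr_eq0 ?sum_max_ge0 ?sqr_ge0 // => /andP[+ _].
    rewrite psumr_eq0; last by move=> g' _; rewrite le_max lexx orbT.
    move=> /allP /(_ g gG) /= /eqP /max_idPr; rewrite oppr_le0 mevalZ.
    by rewrite pmulr_rge0 ?invr_gt0 ?coef_bound_gt0.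
  have := pen0 l (mem_index_enum _).
  rewrite /= paddr_eq0 ?sum_max_ge0 ?sqr_ge0 // => /andP[_].
  by rewrite sqrf_eq0 => /eqP.
pose M : R := \sum_(l < p) (size (G l))%:R.
have M0 : 0 <= M by apply: sumr_ge0.
(* The M weighted penalties cost at most lam * M / k, which must not exceed c / 2. *)
pose k := (Num.truncn (lam * M / (c / 2%:R))).+1.
have kM : lam * M / k%:R <= c / 2%:R.
  rewrite ler_pdivrMr ?ltr0n // [leRHS]mulrC -ler_pdivrMr ?divr_gt0 //.
  by rewrite ltW // /k truncnS_gt.
pose w g := (1 - u g) ^+ k.*2 * u g.
pose h' l := h l - lam *: \sum_(g <- G l) w g + lam *: t l ^+ 2.
have uV l g : g \in G l -> poly_in (V l) (u g) by move=> /GV; exact: poly_inZ.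
have h'V l : poly_in (V l) (h' l).
  apply: poly_inD; last by apply/poly_inZ/poly_inX.
  apply: poly_inB => //; apply: poly_inZ; rewrite big_seq; apply: poly_in_sum => g /uV ug.
  by apply: poly_inM => //; apply/poly_inX/poly_inB => //; exact: poly_in1.
have [|y hy|r hr hE] := sparse_positive_on_box rip tV sos_vars h'V (c := c / 2%:R).
- by rewrite divr_gt0.
- have yA : A y by move=> i; rewrite /= in_itv; exact: hy.
  have h'E : (\sum_(l < p) h' l).@[y ord0]
      = H.@[y ord0] + lam * \sum_(l < p) (\sum_(g <- G l) - (w g).@[y ord0]
          + (t l).@[y ord0] ^+ 2).
    rewrite /H !raddf_sum /= mulr_sumr -big_split /=; apply: eq_bigr => l _.
    rewrite mevalD mevalB !mevalZ rmorphXn /= raddf_sum /= sumrN.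
    by rewrite mulrDr mulrN addrA.
  have penE : pen y - M / k%:R <= \sum_(l < p) (\sum_(g <- G l) - (w g).@[y ord0]
          + (t l).@[y ord0] ^+ 2).
    rewrite /pen /M mulr_suml -sumrB; apply: ler_sum => l _.
    rewrite addrAC lerD2r -sum1_size natr_sum mulr_suml -sumrB.
    apply: ler_sum => g _; rewrite mevalM rmorphXn /= mevalB meval1 mul1r.
    apply: weighted_penalty => //; rewrite mevalZ mulrC.
    exact: coef_boundP.
  rewrite h'E; apply: le_trans (_ : H.@[y ord0] + lam * (pen y - M / k%:R) <= _).
    by have := hc y yA; rewrite mulrBr mulrA => ?; lra.
  by rewrite lerD2l ler_wpM2l.
have /fin_all_exists2 [s sV /fin_all_exists2 [v vV rE]] :
  forall l, exists2 s, sos (V l) s & exists2 v, poly_in (V l) v & r l = s + v * t l by [].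
pose a g := (lam / coef_bound g) *: (1 - u g) ^+ k.*2.
exists (fun l => s l + \sum_(i < size (G l)) (G l)`_i * a (G l)`_i).
exists (fun l => v l - lam *: t l); split.
- move=> l; exists (s l), (fun i => a (G l)`_i); split=> // i.
  apply: sosZ; first by rewrite divr_ge0 // ltW // coef_bound_gt0.
  rewrite -mul2n mulnC exprM; apply/sos_sqr/poly_inX/poly_inB; first exact: poly_in1.
  by apply: uV; rewrite mem_nth.
- by move=> l; apply: poly_inB => //; exact: poly_inZ.
have -> : \sum_(l < p) h l
    = \sum_(l < p) (h' l + lam *: \sum_(g <- G l) w g - lam *: t l ^+ 2).
  by apply: eq_bigr => l _; rewrite /h' addrAC addrK subrK.
rewrite sumrB big_split /= hE -big_split -sumrB /=; apply: eq_bigr => l _.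
rewrite -(big_mkord xpredT (fun i => (G l)`_i * a (G l)`_i)) -(big_nth 0 xpredT (fun g => g * a g)).
have -> : lam *: \sum_(g <- G l) w g = \sum_(g <- G l) g * a g.
  rewrite scaler_sumr; apply: eq_bigr => g _.
  by rewrite /w /a [X in _ * X]/u -!scalerAr scalerA [g * _]mulrC.
by rewrite rE -!mul_mpolyC; ring.
Qed.

End SparsePutinar.

(** * Homogenization *)

Section MonomialSums.
Variables (R : realType) (n : nat) (M : lmodType R) (F : 'X_{1..n} -> M).

Lemma msupp_sum_widen (q : {mpoly R[n]}) (s : seq 'X_{1..n}) :
  uniq s -> {subset msupp q <= s} ->
  \sum_(mo <- msupp q) q@_mo *: F mo = \sum_(mo <- s) q@_mo *: F mo.
Proof.
move=> us qs; rewrite [RHS](bigID (fun mo => mo \in msupp q)) /=.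
rewrite [X in _ = _ + X]big1 ?addr0; last first.
  by move=> mo; rewrite mcoeff_msupp negbK => /eqP ->; rewrite scale0r.
rewrite -[RHS]big_filter; apply: perm_big; apply: uniq_perm.
- exact: msupp_uniq.
- exact: filter_uniq.
by move=> mo; rewrite mem_filter; case: (boolP (mo \in msupp q)) => // /qs ->.
Qed.

Lemma msupp_sumD (q r : {mpoly R[n]}) :
  \sum_(mo <- msupp (q + r)) (q + r)@_mo *: F mo
  = \sum_(mo <- msupp q) q@_mo *: F mo + \sum_(mo <- msupp r) r@_mo *: F mo.
Proof.
pose s := undup (msupp q ++ msupp r).
have widen q' : {subset msupp q' <= msupp q ++ msupp r} ->
    \sum_(mo <- msupp q') q'@_mo *: F mo = \sum_(mo <- s) q'@_mo *: F mo.
  move=> sub; apply: msupp_sum_widen; first exact: undup_uniq.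
  by move=> mo /sub; rewrite mem_undup.
rewrite !widen => [|mo|mo|]; last exact: msuppD_le.
- by rewrite -big_split; apply: eq_bigr => mo _ /=; rewrite mcoeffD scalerDl.
- by rewrite mem_cat orbC => ->.
- by rewrite mem_cat => ->.
Qed.

End MonomialSums.

Section Homogenize.
Variables (R : realType) (n : nat).
Implicit Types (q r : {mpoly R[n]}) (z : 'I_n.+1 -> R).

(** Homogenization in a prescribed degree is additive, unlike [homogenize]. *)
Definition homogenize_deg d q : {mpoly R[n.+1]} :=
  \sum_(mo <- msupp q)
     q@_mo *: ('X_ord0 ^+ (d - mdeg mo) * \prod_(i < n) 'X_(lift ord0 i) ^+ mo i).

Lemma homogenize_deg_sum d p (q : 'I_p -> {mpoly R[n]}) :
  homogenize_deg d (\sum_(l < p) q l) = \sum_(l < p) homogenize_deg d (q l).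
Proof.
apply: (big_morph (homogenize_deg d)) => [q1 q2|]; first exact: msupp_sumD.
by rewrite /homogenize_deg msupp0 big_nil.
Qed.

Lemma poly_in_homogenize_deg d (U : {set 'I_n}) q : poly_in U q ->
  poly_in (ord0 |: [set lift ord0 i | i in U])%SET (homogenize_deg d q).
Proof.
move=> qU; rewrite /homogenize_deg big_seq; apply: poly_in_sum => mo /qU moU.
apply: poly_inZ; apply: poly_inM.
  by apply: poly_inX; apply: poly_in_var; rewrite !inE eqxx.
apply: poly_in_prod => i _.
have [->|/moU iU] := eqVneq (mo i) 0%N; first by rewrite expr0; exact: poly_in1.
apply: poly_inX; apply: poly_in_var; rewrite inE; apply/orP; right.
by apply/imsetP; exists i.
Qed.

Lemma mdeg_le_tdeg q mo : mo \in msupp q -> (mdeg mo <= tdeg q)%N.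
Proof. by move=> /msize_mdeg_lt; rewrite /tdeg; case: (msize q). Qed.

Lemma meval_homogenize q z : (homogenize q).@[z]
  = \sum_(mo <- msupp q) q@_mo * (z ord0 ^+ (tdeg q - mdeg mo)
      * \prod_(i < n) z (lift ord0 i) ^+ mo i).
Proof.
rewrite /homogenize raddf_sum /=; apply: eq_bigr => mo _.
rewrite mevalZ mevalM rmorphXn rmorph_prod /= mevalXU; congr (_ * (_ * _)).
by apply: eq_bigr => i _; rewrite rmorphXn /= mevalXU.
Qed.

Lemma meval_homogenizeZ q z (c : R) :
  (homogenize q).@[fun i => c * z i] = c ^+ tdeg q * (homogenize q).@[z].
Proof.
rewrite !meval_homogenize mulr_sumr big_seq [RHS]big_seq; apply: eq_bigr => mo moq.
under eq_bigr => i _ do rewrite exprMn.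
rewrite big_split /= exprMn prodrXr -mdegE.
have -> : c ^+ tdeg q = c ^+ (tdeg q - mdeg mo) * c ^+ mdeg mo.
  by rewrite -exprD subnK // mdeg_le_tdeg.
move: (c ^+ (_ - _)) (c ^+ mdeg _) (z ord0 ^+ _) (\prod_(i < n) _) => c1 c2 z1 z2.
by ring.
Qed.

Lemma meval_homogenize1 q z : z ord0 = 1 ->
  (homogenize q).@[z] = q.@[fun i => z (lift ord0 i)].
Proof.
move=> z0; rewrite meval_homogenize mevalE; apply: eq_bigr => mo _.
by rewrite z0 expr1n mul1r.
Qed.

Lemma meval_homogenize_finite q z : z ord0 != 0 ->
  (homogenize q).@[z] = z ord0 ^+ tdeg q * q.@[fun i => z (lift ord0 i) / z ord0].
Proof.
move=> z0; rewrite -(@meval_homogenize1 q (fun i => z i / z ord0)) ?divff //.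
rewrite -meval_homogenizeZ; apply: meval_eq => i.
by rewrite mulrC divfK.
Qed.

Lemma meval_homogenize_infinity q z : z ord0 = 0 ->
  (homogenize q).@[z] = (top_form q).@[fun i => z (lift ord0 i)].
Proof.
move=> z0; rewrite meval_homogenize /top_form /pihomog raddf_sum /= [RHS]big_mkcond.
rewrite big_seq [RHS]big_seq; apply: eq_bigr => mo moq.
rewrite mevalZ mevalX z0 expr0n subn_eq0.
have := mdeg_le_tdeg moq; case: ltngtP => // _ _; first by rewrite mul0r mulr0.
by rewrite mul1r.
Qed.

End Homogenize.

Lemma sqnorm_eq0 (R : realType) k (x : 'rV[R]_k) :
  sqnorm x = 0 -> forall i, x ord0 i = 0.
Proof.
move=> /eqP; rewrite psumr_eq0 => [/allP x0 i|i _]; last exact: sqr_ge0.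
by have := x0 i (mem_index_enum _); rewrite /= sqrf_eq0 => /eqP.
Qed.

Section FeasibleHom.
Variables (R : realType) (n m : nat).
Variables (f : {mpoly R[n]}) (g : 'I_m -> {mpoly R[n]}).
Implicit Types z : 'rV[R]_n.+1.

Lemma feasible_dehomogenize z : feasible_hom g z -> 0 < z ord0 ord0 ->
  feasible g (\row_i (z ord0 (lift ord0 i) / z ord0 ord0)).
Proof.
move=> [zg _ _] z0 j; have := zg j; rewrite meval_homogenize_finite ?gt_eqF //.
rewrite pmulr_rge0 ?exprn_gt0 //; congr (0 <= _).
by apply: meval_eq => i; rewrite mxE.
Qed.

Lemma meval_homogenize_row z : z ord0 ord0 != 0 ->
  (homogenize f).@[z ord0] = z ord0 ord0 ^+ tdeg f
     * f.@[(\row_i (z ord0 (lift ord0 i) / z ord0 ord0) : 'rV[R]_n) ord0].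
Proof.
move=> z0; rewrite meval_homogenize_finite //; congr (_ * _).
by apply: meval_eq => i; rewrite mxE.
Qed.

(** At infinity the inequality is inherited from the finite points by continuity;
    this is where closedness at infinity enters. *)
Lemma homogenize_ge0_feasible_hom : closed_at_infinity g ->
  (forall x, feasible g x -> 0 <= f.@[x ord0]) ->
  forall z, feasible_hom g z -> 0 <= (homogenize f).@[z ord0].
Proof.
move=> gcl f0 z; rewrite gcl => zcl.
have cl : closed [set z : 'rV[R]_n.+1 | 0 <= (homogenize f).@[z ord0]].
  apply: (closed_comp (f := fun z : 'rV[R]_n.+1 => (homogenize f).@[z ord0])
    (D := [set x | 0 <= x])) => [y _|]; last exact: closed_ge.
  exact: continuous_meval.
apply: cl; apply: closure_subset zcl => y [yg /= y0].
rewrite meval_homogenize_row ?gt_eqF //; apply: mulr_ge0.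
  by rewrite exprn_ge0 // ltW.
exact/f0/feasible_dehomogenize.
Qed.

Lemma homogenize_gt0_feasible_hom :
  (forall x, feasible g x -> 0 < f.@[x ord0]) -> positive_at_infinity f g ->
  forall z, feasible_hom g z -> 0 < (homogenize f).@[z ord0].
Proof.
move=> f0 finf z zg; have [zg' z0 z1] := zg.
have [z00|z00] := eqVneq (z ord0 ord0) 0; last first.
  have z0' : 0 < z ord0 ord0 by rewrite lt_neqAle eq_sym z00.
  rewrite meval_homogenize_row // mulr_gt0 ?exprn_gt0 //.
  exact/f0/feasible_dehomogenize.
have tailE q : (homogenize q).@[z ord0]
    = (top_form q).@[(\row_i z ord0 (lift ord0 i) : 'rV[R]_n) ord0].
  by rewrite meval_homogenize_infinity //; apply: meval_eq => i; rewrite mxE.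
rewrite tailE; apply: finf; split=> [j|]; first by rewrite -tailE.
move: z1; rewrite /sqnorm big_ord_recl z00 expr0n add0r => <-.
by apply: eq_bigr => i _; rewrite mxE.
Qed.

(** The homogenized constraints describe a cone, with section [feasible_hom g]. *)
Lemma homogenized_cone_cases z : (forall j, 0 <= (homogenize (g j)).@[z ord0]) ->
  0 <= z ord0 ord0 ->
  (forall i, z ord0 i = 0) \/
  exists2 c, 0 < c & exists2 z', feasible_hom g z' & forall i, z ord0 i = c * z' ord0 i.
Proof.
move=> zg z0; have [/eqP|zpos] := eqVneq (sqnorm z) 0.
  by move/eqP/sqnorm_eq0; left.
have {}zpos : 0 < sqnorm z by rewrite lt_neqAle eq_sym zpos sumr_ge0 // => i _; exact: sqr_ge0.
right; pose c := Num.sqrt (sqnorm z).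
have c0 : 0 < c by rewrite sqrtr_gt0.
have zE i : z ord0 i = c * (c^-1 *: z) ord0 i by rewrite mxE mulVKf ?gt_eqF.
exists c => //; exists (c^-1 *: z) => //; split.
- move=> j; have := zg j; rewrite (meval_eq _ (zE)) meval_homogenizeZ.
  by rewrite pmulr_rge0 ?exprn_gt0.
- by rewrite mxE mulr_ge0 // invr_ge0 ltW.
rewrite /sqnorm; under eq_bigr => i _ do rewrite mxE exprMn.
by rewrite -mulr_sumr exprVn sqr_sqrtr ?ltW // mulVf ?gt_eqF.
Qed.

(** At the origin the value is 0 in positive degree; in degree 0 it is the value
    of the constant objective at a feasible point. *)
Lemma homogenize_ge0_origin z : (tdeg f = 0%N -> feasible g !=set0) ->
  (forall x, feasible g x -> 0 <= f.@[x ord0]) -> (forall i, z ord0 i = 0) ->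
  0 <= (homogenize f).@[z ord0].
Proof.
move=> fconst f0 z0; have [d0|d_neq0] := eqVneq (tdeg f) 0%N.
  have [x xg] := fconst d0.
  pose v (i : 'I_n.+1) := if unlift ord0 i is Some j then x ord0 j else 1.
  rewrite (meval_eq (v2 := fun i => 0 * v i)) => [|i]; last by rewrite z0 mul0r.
  rewrite meval_homogenizeZ d0 expr0 mul1r meval_homogenize1 /v ?unlift_none //.
  by under meval_eq => i do rewrite liftK; exact: f0.
rewrite (meval_eq (v2 := fun i => 0 * z ord0 i)) => [|i]; last by rewrite z0 mul0r.
by rewrite meval_homogenizeZ expr0n (negbTE d_neq0) mul0r.
Qed.

End FeasibleHom.

(** * The sparse blocks of homogenized variables *)

Section Blocks.
Variables (R : realType) (n m p : nat).
Variables (X : 'I_p -> {set 'I_n}) (J : 'I_p -> {set 'I_m}).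
Local Notation N := (n.+1 + p)%N.

Lemma xvar0_block l : xvar p ord0 \in block X l.
Proof. by rewrite !inE eqxx orbT. Qed.

Lemma wvar_block k l : (wvar n k \in block X l) = (k == l).
Proof.
rewrite !inE (inj_eq (@rshift_inj _ _)) eq_rlshift /=.
by case: imsetP => [[i _ /eqP]|]; rewrite ?eq_rlshift ?orbF.
Qed.

Lemma xvar_block i l : (xvar p (lift ord0 i) \in block X l) = (i \in X l).
Proof.
rewrite !inE eq_lrshift (inj_eq (@lshift_inj _ _)) eq_sym (negbTE (neq_lift _ _)) /=.
apply: (mem_imset (f := fun i => xvar p (lift ord0 i))).
by move=> a b /lshift_inj /lift_inj.
Qed.

Lemma running_intersection_block :
  running_intersection X -> running_intersection (block X).
Proof.
move=> rip k k0; have [s sk sub] := rip k k0; exists s => //.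
apply/fintype.subsetP => i; rewrite inE => /andP[ik /bigcupP[j jk ij]].
case: (split_ordP i) => [a iE|a iE]; rewrite {i}iE in ik ij *; last first.
  move: ik ij; rewrite !wvar_block => /eqP -> /eqP kj.
  by rewrite kj ltnn in jk.
case: (unliftP ord0 a) => [b aE|->]; last exact: xvar0_block.
rewrite {a}aE in ik ij *; rewrite !xvar_block in ik ij *.
by apply: (fintype.subsetP sub); rewrite inE ik; apply/bigcupP; exists j.
Qed.

Lemma block_sphereE l :
  block_sphere R X l = \sum_(i in block X l) 'X_i ^+ 2 - 1.
Proof.
rewrite /block big_setU1 /=; first by rewrite /block_sphere [X in X - 1]addrC.
rewrite !inE eq_rlshift; apply/imsetP => -[i _ /eqP].
by rewrite eq_rlshift.
Qed.

Lemma poly_in_block_sphere l : poly_in (block X l) (block_sphere R X l).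
Proof.
rewrite block_sphereE; apply: poly_inB; last exact: poly_in1.
by apply: poly_in_sum => i il; apply/poly_inX/poly_in_var.
Qed.

(** Modulo the sphere equation 1 - x_i ^ 2 is the sum of the squares of the other
    variables. *)
Lemma sos_mod_block_sphere l i : i \in block X l ->
  sos_mod (block X l) (block_sphere R X l) (1 + 'X_i)
  /\ sos_mod (block X l) (block_sphere R X l) (1 - 'X_i).
Proof.
move=> il.
have main (q : {mpoly R[N]}) : poly_in (block X l) q -> q ^+ 2 = 'X_i ^+ 2 ->
    sos_mod (block X l) (block_sphere R X l) (1 + q).
  move=> qV qE.
  pose S : {mpoly R[N]} := \sum_(j in block X l | j != i) 'X_j ^+ 2.
  have sphereE : block_sphere R X l = q ^+ 2 + S - 1.
    by rewrite block_sphereE (bigD1 i) //= qE.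
  exists (2%:R^-1 *: ((1 + q) ^+ 2 + S)).
    apply: sosZ; first by rewrite invr_ge0.
    apply: sosD; first by apply/sos_sqr/poly_inD => //; exact: poly_in1.
    by apply: sos_sum => j /andP[jl _]; apply/sos_sqr/poly_in_var.
  exists (- 2%:R^-1 *: 1); first by apply/poly_inZ/poly_in1.
  rewrite sphereE -scalerAl mul1r scaleNr -scalerBr.
  have -> : (1 + q) ^+ 2 + S - (q ^+ 2 + S - 1) = 2%:R *: (1 + q).
    by rewrite scaler_nat; ring.
  by rewrite scalerA mulVf ?scale1r // pnatr_eq0.
split; first by apply: main => //; exact: poly_in_var.
by apply: main; [rewrite -scaleN1r; apply/poly_inZ/poly_in_var | rewrite sqrrN].
Qed.

Lemma poly_in_hom_ext_deg d (q : {mpoly R[n]}) l : poly_in (X l) q ->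
  poly_in (block X l) (homogenize_deg d q \mPo [tuple 'X_(xvar p i) | i < n.+1]).
Proof.
move=> /(@poly_in_homogenize_deg _ _ d) qU; apply: (poly_in_comp qU) => i.
rewrite tnth_mktuple !inE => /orP[/eqP ->|/imsetP[j jl ->]]; apply: poly_in_var.
  exact: xvar0_block.
by rewrite xvar_block.
Qed.

Lemma poly_in_block_gens (g : 'I_m -> {mpoly R[n]}) l q :
  (forall j, j \in J l -> poly_in (X l) (g j)) ->
  q \in block_gens g J l -> poly_in (block X l) q.
Proof.
move=> gX; rewrite inE => /orP[/eqP ->|/mapP[j]].
  by apply: poly_in_var; exact: xvar0_block.
by rewrite mem_enum => /gX /poly_in_hom_ext_deg gj ->; exact: gj.
Qed.

Definition block_sum (q : {mpoly R[N]}) : Prop :=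
  exists2 h : 'I_p -> {mpoly R[N]},
    forall l, poly_in (block X l) (h l) & q = \sum_(l < p) h l.

Lemma block_sumD q r : block_sum q -> block_sum r -> block_sum (q + r).
Proof.
move=> [h hV ->] [k kV ->]; exists (fun l => h l + k l); last by rewrite big_split.
by move=> l; exact: poly_inD.
Qed.

Lemma block_sumZ (c : R) q : block_sum q -> block_sum (c *: q).
Proof.
move=> [h hV ->]; exists (fun l => c *: h l); last by rewrite scaler_sumr.
by move=> l; exact: poly_inZ.
Qed.

Lemma block_sum_in l q : poly_in (block X l) q -> block_sum q.
Proof.
move=> ql; exists (fun k => if k == l then q else 0) => [k|].
  by case: eqP => [->|_] //; exact: poly_in0.
by rewrite -big_mkcond big_pred1_eq.
Qed.

Lemma block_sum_sum (I : finType) (F : I -> {mpoly R[N]}) :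
  (forall i, block_sum (F i)) -> block_sum (\sum_i F i).
Proof.
move=> hF; apply: (big_ind block_sum) => //; last exact: block_sumD.
exists (fun=> 0) => [l|]; [exact: poly_in0 | by rewrite big1].
Qed.

Lemma block_sum_hom_ext (f : {mpoly R[n]}) (fl : 'I_p -> {mpoly R[n]}) :
  (forall l, poly_in (X l) (fl l)) -> f = \sum_(l < p) fl l ->
  block_sum (hom_ext p f).
Proof.
move=> flX fE; exists (fun l => homogenize_deg (tdeg f) (fl l)
  \mPo [tuple 'X_(xvar p i) | i < n.+1]) => [l|]; first exact: poly_in_hom_ext_deg.
have : homogenize f = homogenize_deg (tdeg f) (\sum_(l < p) fl l) by rewrite -fE.
by rewrite /hom_ext => ->; rewrite homogenize_deg_sum raddf_sum.
Qed.

Lemma meval_hom_ext (q : {mpoly R[n]}) (y : 'rV[R]_N) :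
  (hom_ext p q).@[y ord0]
  = (homogenize q).@[(\row_i y ord0 (xvar p i) : 'rV[R]_n.+1) ord0].
Proof.
rewrite comp_mpoly_meval; apply: meval_eq => i.
by rewrite tnth_mktuple mevalXU mxE.
Qed.

End Blocks.

(** * Certificates from positivity *)

Section Certificate.
Variables (R : realType) (n m p : nat) (p_gt0 : (0 < p)%N).
Variables (f : {mpoly R[n]}) (g : 'I_m -> {mpoly R[n]}).
Variables (X : 'I_p -> {set 'I_n}) (J : 'I_p -> {set 'I_m}).
Local Notation N := (n.+1 + p)%N.

(** Only the consequence at [x = 0] of the sphere equations is kept: elsewhere the
    polynomials to be certified are positive on the whole cone of the homogenized
    constraints. *)
Lemma sparse_certificate_of_pos (h : {mpoly R[N]}) :
  correlative_sparsity f g X J -> running_intersection X -> block_sum X h ->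
  (forall y : 'rV[R]_N,
     (forall j, 0 <= (homogenize (g j)).@[(\row_i y ord0 (xvar p i) : 'rV[R]_n.+1) ord0]) ->
     0 <= y ord0 (xvar p ord0) ->
     ((forall i, y ord0 (xvar p i) = 0) -> forall l, y ord0 (wvar n l) ^+ 2 = 1) ->
     0 < h.@[y ord0]) ->
  sparse_certificate g X J h.
Proof.
move=> [_ _ [Jcover _] gX] /running_intersection_block rip [hl hlV ->] hpos.
apply: (sparse_putinar rip) => //.
- by move=> l; exact: poly_in_block_sphere.
- by move=> l i; exact: sos_mod_block_sphere.
- by move=> l q; apply: poly_in_block_gens; exact: gX.
move=> y yG yS; apply: hpos => [j||y0 l].
- have : j \in (\bigcup_(l < p) J l)%SET by rewrite Jcover inE.
  move=> /bigcupP[l _ jl]; rewrite -meval_hom_ext; apply: (yG l).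
  by rewrite inE; apply/orP; right; apply/mapP; exists j; rewrite ?mem_enum.
- by have := yG (Ordinal p_gt0) 'X_(xvar p ord0); rewrite inE eqxx mevalXU; apply.
have := yS l; rewrite /block_sphere mevalB mevalD raddf_sum /= meval1 big1.
  by rewrite add0r rmorphXn /= mevalXU => /eqP; rewrite subr_eq0 => /eqP.
move=> i; rewrite rmorphXn /= mevalXU !inE => /orP[/eqP ->|/imsetP[a _ ->]];
  by rewrite y0 expr0n.
Qed.

End Certificate.

Theorem theorem3p8 (R : realType) (n m p : nat) (p_gt0 : (0 < p)%N)
    (f : {mpoly R[n]}) (g : 'I_m -> {mpoly R[n]})
    (X : 'I_p -> {set 'I_n}) (J : 'I_p -> {set 'I_m})
    (f_inf : (-oo < ereal_inf [set (f.@[x ord0])%:E | x in feasible g])%E)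
    (f_const : tdeg f = 0%N -> feasible g !=set0)
    (K_closed : closed_at_infinity g)
    (csp : correlative_sparsity f g X J)
    (rip : running_intersection X) :
  let d0 := (uphalf (tdeg f)).*2 in
  ((forall x, feasible g x -> 0 <= f.@[x ord0]) ->
   forall eps : R, 0 < eps ->
     sparse_certificate g X J
       (hom_ext p f
        + eps *: (\sum_(i < n.+1) 'X_(xvar p i) ^+ d0
                  + \sum_(l < p) 'X_(wvar n l) ^+ d0)))
  /\
  ((forall x, feasible g x -> 0 < f.@[x ord0]) ->
   positive_at_infinity f g ->
   forall eps : R, 0 < eps ->
     sparse_certificate g X J
       (hom_ext p f + eps *: \sum_(l < p) 'X_(wvar n l) ^+ d0)).
Proof.
move=> d0.
have [Xcover [fl [flX fE]] _ _] := csp.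
have f_sum : block_sum X (hom_ext p f) := block_sum_hom_ext flX fE.
have w_sum : block_sum X (\sum_(l < p) 'X_(wvar n l) ^+ d0 : {mpoly R[n.+1 + p]}).
  apply: block_sum_sum => l; apply: (block_sum_in (l := l)); apply/poly_inX/poly_in_var.
  by rewrite wvar_block.
have x_sum : block_sum X (\sum_(i < n.+1) 'X_(xvar p i) ^+ d0 : {mpoly R[n.+1 + p]}).
  apply: block_sum_sum => i; case: (unliftP ord0 i) => [j ->|->].
    have : j \in (\bigcup_(l < p) X l)%SET by rewrite Xcover inE.
    move=> /bigcupP[l _ jl]; apply: (block_sum_in (l := l)).
    by apply/poly_inX/poly_in_var; rewrite xvar_block.
  apply: (block_sum_in (l := Ordinal p_gt0)).
  by apply/poly_inX/poly_in_var; exact: xvar0_block.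
have pow_ge0 (a : R) : 0 <= a ^+ d0 by rewrite /d0 -mul2n exprM exprn_ge0 // sqr_ge0.
have powE I (s : seq I) (v : I -> 'I_(n.+1 + p)) (y : 'rV[R]_(n.+1 + p)) :
    (\sum_(i <- s) 'X_(v i) ^+ d0 : {mpoly R[n.+1 + p]}).@[y ord0]
    = \sum_(i <- s) y ord0 (v i) ^+ d0.
  by rewrite raddf_sum /=; apply: eq_bigr => i _; rewrite rmorphXn /= mevalXU.
have sum_w_gt0 (y : 'rV[R]_(n.+1 + p)) : (forall l, y ord0 (wvar n l) ^+ 2 = 1) ->
    0 < \sum_(l < p) y ord0 (wvar n l) ^+ d0.
  move=> yw; rewrite (eq_bigr (fun=> 1)) => [|l _].
    by rewrite sumr_const card_ord ltr0n.
  by rewrite /d0 -mul2n exprM yw expr1n.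
split=> [f0|f0 finf] eps eps0.
- apply: (sparse_certificate_of_pos p_gt0 csp rip).
    by apply: block_sumD => //; apply: block_sumZ; exact: block_sumD.
  move=> y yg y0 yw; rewrite mevalD mevalZ mevalD !powE meval_hom_ext.
  set z : 'rV[R]_n.+1 := \row_i _ in yg *.
  have zE i : y ord0 (xvar p i) = z ord0 i by rewrite mxE.
  have z0 : 0 <= z ord0 ord0 by rewrite -zE.
  have [z_eq0|[c c0 [z' z'g zz']]] := homogenized_cone_cases yg z0.
    apply: ltr_wpDl; first exact: homogenize_ge0_origin f_const f0 z_eq0.
    rewrite mulr_gt0 // ltr_wpDl ?sumr_ge0 //; apply/sum_w_gt0/yw => i.
    by rewrite zE z_eq0.
  apply: ltr_wpDl.
    rewrite (meval_eq _ zz') meval_homogenizeZ mulr_ge0 ?exprn_ge0 ?(ltW c0) //.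
    exact: homogenize_ge0_feasible_hom K_closed f0 _ z'g.
  rewrite mulr_gt0 // ltr_pwDl ?sumr_ge0 //.
  rewrite lt_neqAle eq_sym sumr_ge0 // andbT psumr_eq0 //.
  apply/negP => /allP z_eq0; have [_ _ /eqP] := z'g.
  rewrite /sqnorm big1 ?(eq_sym 0) ?oner_eq0 // => i _.
  have := z_eq0 i (mem_index_enum _); rewrite /= zE zz' expf_eq0 => /andP[_].
  by rewrite mulf_eq0 gt_eqF //= => /eqP ->; rewrite expr0n.
- apply: (sparse_certificate_of_pos p_gt0 csp rip).
    by apply: block_sumD => //; exact: block_sumZ.
  move=> y yg y0 yw; rewrite mevalD mevalZ powE meval_hom_ext.
  set z : 'rV[R]_n.+1 := \row_i _ in yg *.
  have zE i : y ord0 (xvar p i) = z ord0 i by rewrite mxE.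
  have z0 : 0 <= z ord0 ord0 by rewrite -zE.
  have [z_eq0|[c c0 [z' z'g zz']]] := homogenized_cone_cases yg z0.
    apply: ltr_wpDl.
      by apply: homogenize_ge0_origin f_const _ z_eq0 => x /f0 /ltW.
    rewrite mulr_gt0 //; apply/sum_w_gt0/yw => i.
    by rewrite zE z_eq0.
  apply: ltr_pwDl; last by rewrite mulr_ge0 ?(ltW eps0) ?sumr_ge0.
  rewrite (meval_eq _ zz') meval_homogenizeZ mulr_gt0 ?exprn_gt0 //.
  exact: homogenize_gt0_feasible_hom f0 finf _ z'g.
Qed.
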